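(* Let $S$ be a monoid, let $A$ be a right $S$-act, and let $B$ be a fully invariant subact of $A$. If $B$ and the Rees factor act $A/B$ are both strongly Hopfian, then $A$ is strongly Hopfian.
   Context: $S$ is a monoid. A (right) $S$-act is a non-empty set $A$ with a map $A\times S\to A$, $(a,s)\mapsto as$, satisfying $a1=a$ and $a(st)=(as)t$ for all $a\in A$, $s,t\in S$. An $S$-homomorphism $f:A\to B$ is a map with $f(as)=f(a)s$ for all $a\in A$, $s\in S$; $\mathrm{End}_S(A)$ is the monoid of $S$-homomorphisms $A\to A$ (endomorphisms) under composition. A subact of $A$ is a non-empty subset $B\subseteq A$ with $bs\in B$ for all $b\in B$, $s\in S$. It is fully invariant if $f(B)\subseteq B$ for every $f\in \mathrm{End}_S(A)$. A congruence on $A$ is an equivalence relation $\theta$ on $A$ such that $a\,\theta\, a'$ implies $as\,\theta\, a's$ for all $s\in S$; then $A/\theta$ is an $S$-act via $[a]_\theta s=[as]_\theta$. The Rees congruence $\rho_B$ of a subact $B$ is defined by: $a\,\rho_B\, a'$ iff $a,a'\in B$ or $a=a'$. The Rees factor act is $A/B:=A/\rho_B$. For $f\in \mathrm{End}_S(A)$ put $\mathcal{K}_f=\{(a_1,a_2)\in A\times A\mid f(a_1)=f(a_2)\}$. The $S$-act $A$ is strongly Hopfian if for every $f\in\mathrm{End}_S(A)$ the ascending chain $\mathcal{K}_f\subseteq \mathcal{K}_{f^2}\subseteq \mathcal{K}_{f^3}\subseteq\cdots$ stabilizes, i.e. there is a positive integer $n$ with $\mathcal{K}_{f^m}=\mathcal{K}_{f^n}$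 for all $m\ge n$. *)

(* Defs.v *)
From HB Require Import structures.
From mathcomp Require Import all_boot.
From mathcomp Require Import boolp classical_sets.

Set Implicit Arguments.
Unset Strict Implicit.
Unset Printing Implicit Defensive.

Import Algebra.

Local Open Scope classical_set_scope.
Local Open Scope quotient_scope.

(* Right S-acts.  The choice structure is no restriction on the carrier: every
   type gets one classically, by boolp.gen_eqMixin and boolp.gen_choiceMixin. *)
HB.mixin Record isAct (S : monoidType) A of Choice A := {
  act : A -> S -> A;
  act_inhabited : inhabited A;
  act1 : forall a, act a 1%g = a;
  actM : forall a s t, act a (s * t)%g = act (act a s) t
}.

#[short(type="actType")]
HB.structure Definition Act (S : monoidType) := {A of isAct S A & Choice A}.

Definition act_hom (S : monoidType) (A B : actType S) (f : A -> B) : Prop :=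
  forall (a : A) (s : S), f (act a s) = act (f a) s.

Definition ker_pair (T U : Type) (f : T -> U) : set (T * T) :=
  [set p | f p.1 = f p.2].

(* [iter n f] is the n-th power of f in the monoid of endomorphisms. *)
Definition strongly_hopfian (S : monoidType) (A : actType S) : Prop :=
  forall f : A -> A, act_hom f ->
    exists n : nat, 0 < n /\
      forall m : nat, n <= m -> ker_pair (iter m f) = ker_pair (iter n f).

Record subact (S : monoidType) (A : actType S) := Subact {
  subact_set :> set A;
  subact_nonempty : subact_set !=set0;
  subact_closed : forall (b : A) (s : S), subact_set b -> subact_set (act b s)
}.

Definition fully_invariant (S : monoidType) (A : actType S) (B : subact A) :
  Prop := forall f : A -> A, act_hom f -> f @` B `<=` B.

Section SubactAct.
Variables (S : monoidType) (A : actType S) (B : subact A).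

Definition subact_type : Type := set_type B.
HB.instance Definition _ := Choice.on subact_type.

Lemma subact_act_subproof (b : subact_type) (s : S) :
  act (val b) s \in (B : set A).
Proof. by rewrite inE; apply: subact_closed; exact: set_valP. Qed.

Definition subact_act (b : subact_type) (s : S) : subact_type :=
  exist _ (act (val b) s) (subact_act_subproof b s).

Lemma subact_act_inhabited : inhabited subact_type.
Proof.
have [b Bb] := subact_nonempty B.
exact: (inhabits (exist _ b (mem_set Bb))).
Qed.

Lemma subact_act1 (b : subact_type) : subact_act b 1%g = b.
Proof. by apply: val_inj; rewrite /= act1. Qed.

Lemma subact_actM (b : subact_type) (s t : S) :
  subact_act b (s * t)%g = subact_act (subact_act b s) t.
Proof. by apply: val_inj; rewrite /= actM. Qed.

HB.instance Definition _ := isAct.Build S subact_type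
  subact_act_inhabited subact_act1 subact_actM.

End SubactAct.

Record congruence (S : monoidType) (A : actType S) := Congruence {
  cong_rel :> equiv_rel A;
  cong_act : forall (a a' : A) (s : S),
    cong_rel a a' -> cong_rel (act a s) (act a' s)
}.

Section QuotientAct.
Variables (S : monoidType) (A : actType S) (theta : congruence A).

Definition quot_act_type : Type := {eq_quot theta}.
HB.instance Definition _ := EqQuotient.on quot_act_type.
HB.instance Definition _ := Choice.on quot_act_type.

Definition quot_act (x : quot_act_type) (s : S) : quot_act_type :=
  \pi_quot_act_type (act (repr x) s).

Lemma quot_act_pi (a : A) (s : S) :
  quot_act (\pi_quot_act_type a) s = \pi_quot_act_type (act a s).
Proof.
apply/eqmodP; apply: cong_act; apply/eqmodP.
by rewrite reprK.
Qed.

Lemma quot_act_inhabited : inhabited quot_act_type.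
Proof.
have [a] := act_inhabited (s := A).
exact: (inhabits (\pi_quot_act_type a)).
Qed.

Lemma quot_act1 (x : quot_act_type) : quot_act x 1%g = x.
Proof. by rewrite -[x]reprK quot_act_pi act1. Qed.

Lemma quot_actM (x : quot_act_type) (s t : S) :
  quot_act x (s * t)%g = quot_act (quot_act x s) t.
Proof.
rewrite -[x]reprK quot_act_pi actM.
by rewrite (quot_act_pi _ s) quot_act_pi.
Qed.

HB.instance Definition _ := isAct.Build S quot_act_type
  quot_act_inhabited quot_act1 quot_actM.

End QuotientAct.

Section Rees.
Variables (S : monoidType) (A : actType S) (B : subact A).

Definition rees_rel : rel A :=
  fun a a' => `[< (subact_set B a /\ subact_set B a') \/ a = a' >].

Lemma rees_refl : reflexive rees_rel.
Proof. by move=> a; apply/asboolP; right. Qed.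

Lemma rees_sym : symmetric rees_rel.
Proof.
by move=> a a'; apply/asboolP/asboolP => -[[Ba Ba']|->]; [left|right|left|right].
Qed.

Lemma rees_trans : transitive rees_rel.
Proof.
move=> b a c /asboolP[[Ba Bb]|->] // /asboolP[[_ Bc]|<-].
  by apply/asboolP; left.
by apply/asboolP; left.
Qed.

Lemma rees_act (a a' : A) (s : S) :
  rees_rel a a' -> rees_rel (act a s) (act a' s).
Proof.
move=> /asboolP[[Ba Ba']|->]; last exact: rees_refl.
by apply/asboolP; left; split; exact: subact_closed.
Qed.

Definition rees_congruence : congruence A :=
  @Congruence S A (EquivRel rees_rel rees_refl rees_sym rees_trans) rees_act.

Definition rees_factor : actType S := quot_act_type rees_congruence.

End Rees.

(* Main.v *)
Require Import Defs.
From mathcomp Require Import all_boot.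
From mathcomp Require Import boolp classical_sets.

(** An endomorphism f of A maps B into itself by full invariance, so it
    restricts to B and induces an endomorphism of A/B.  Let n and k be indices
    at which the kernels of the powers of these two maps stabilize; then the
    kernels of the powers of f stabilize at k + n.  Indeed, if f^m identifies
    a and a' with m >= k + n, then so does its power on A/B, hence f^k a and
    f^k a' are equal modulo B: either they are equal, or both lie in B.  In
    the latter case f^(m-k) identifies these two points of B and m - k >= n,
    so f^n already identifies them. *)

Set Implicit Arguments.
Unset Strict Implicit.
Unset Printing Implicit Defensive.

Local Open Scope classical_set_scope.
Local Open Scope quotient_scope.

Lemma iter_semiconj (T U : Type) (p : T -> U) (f : T -> T) (g : U -> U) :
  (forall x, p (f x) = g (p x)) ->
  forall n x, p (iter n f x) = iter n g (p x).
Proof. by move=> pfg; elim=> [|n IHn] x //=; rewrite pfg IHn. Qed.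

(** Since the kernels of the powers of f always increase, only the inclusions
    backwards to the index n have to be checked. *)
Lemma strongly_hopfianP (S : monoidType) (A : actType S) :
  strongly_hopfian A <->
  forall f : A -> A, act_hom f -> exists n : nat, 0 < n /\
    forall m a a', n <= m -> iter m f a = iter m f a' ->
      iter n f a = iter n f a'.
Proof.
split=> hA f /hA [n [n_gt0 stab]]; exists n; split=> // m.
  move=> a a' le_nm eq_m; have: ker_pair (iter m f) (a, a') by [].
  by rewrite stab.
move=> le_nm; apply/seteqP; split=> -[a a'] /= eq_aa'.
  exact: stab le_nm eq_aa'.
by rewrite /ker_pair /= -(subnK le_nm) !iterD eq_aa'.
Qed.

Section FullyInvariant.
Variables (S : monoidType) (A : actType S) (B : subact A).
Variable f : A -> A.
Hypotheses (homf : act_hom f) (fB : f @` B `<=` B).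

Lemma restrict_subproof (b : subact_type B) : f (val b) \in (B : set A).
Proof. by rewrite inE; apply: fB; exists (val b) => //; exact: set_valP. Qed.

(** The restriction of f to B. *)
Definition restrict (b : subact_type B) : subact_type B :=
  exist _ (f (val b)) (restrict_subproof b).

Lemma restrict_hom : act_hom restrict.
Proof. by move=> b s; apply: val_inj; rewrite /= homf. Qed.

Lemma iter_restrict n (b : subact_type B) :
  val (iter n restrict b) = iter n f (val b).
Proof. exact: iter_semiconj. Qed.

(** The class of an element in the Rees factor A/B. *)
Definition rees_pi (a : A) : rees_factor B :=
  \pi_(quot_act_type (rees_congruence B)) a.

Lemma rees_piP (a a' : A) :
  rees_pi a = rees_pi a' <-> (subact_set B a /\ subact_set B a') \/ a = a'.
Proof.
split=> [/eqmodP/asboolP //|BaBa'].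
by apply/eqmodP/asboolP.
Qed.

Lemma rees_pi_surj (x : rees_factor B) : exists a, rees_pi a = x.
Proof. by exists (repr x); exact: reprK. Qed.

Lemma rees_pi_hom : act_hom rees_pi.
Proof. by move=> a s; rewrite /act /= quot_act_pi. Qed.

(** The endomorphism of A/B induced by f; it does not depend on the chosen
    representatives by [rees_map_pi]. *)
Definition rees_map (x : rees_factor B) : rees_factor B :=
  rees_pi (f (repr (x : quot_act_type (rees_congruence B)))).

Lemma rees_map_pi a : rees_pi (f a) = rees_map (rees_pi a).
Proof.
rewrite /rees_map; set r := repr _.
have /rees_piP[[Ba Br]|-> //] : rees_pi a = rees_pi r by rewrite /rees_pi reprK.
by apply/rees_piP; left; split; apply: fB; [exists a | exists r].
Qed.

Lemma rees_map_hom : act_hom rees_map.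
Proof.
move=> x s; have [a <-] := rees_pi_surj x.
by rewrite -rees_pi_hom -!rees_map_pi homf rees_pi_hom.
Qed.

Lemma iter_rees_map n a : rees_pi (iter n f a) = iter n rees_map (rees_pi a).
Proof. exact: (iter_semiconj rees_map_pi). Qed.

End FullyInvariant.

Theorem theorem3p10 (S : monoidType) (A : actType S) (B : subact A) :
  fully_invariant B ->
  strongly_hopfian (subact_type B) ->
  strongly_hopfian (rees_factor B) ->
  strongly_hopfian A.
Proof.
move=> invB /strongly_hopfianP hB /strongly_hopfianP hAB.
apply/strongly_hopfianP => f homf; have fB := invB f homf.
have [n [n_gt0 stabB]] := hB _ (restrict_hom homf fB).
have [k [_ stabAB]] := hAB _ (rees_map_hom homf fB).
exists (n + k); split=> [|m a a' le_nk_m eq_m]; first by rewrite addn_gt0 n_gt0.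
have le_km : k <= m := leq_trans (leq_addl n k) le_nk_m.
have : rees_pi B (iter k f a) = rees_pi B (iter k f a').
  rewrite !(iter_rees_map fB); apply: (stabAB m) => //.
  by rewrite -!(iter_rees_map fB) eq_m.
rewrite !iterD => /rees_piP[[Ba Ba']|-> //].
pose b : subact_type B := exist _ (iter k f a) (mem_set Ba).
pose b' : subact_type B := exist _ (iter k f a') (mem_set Ba').
suff /(congr1 val) : iter n (restrict fB) b = iter n (restrict fB) b'.
  by rewrite !iter_restrict.
apply: (stabB (m - k)); first by rewrite leq_subRL // addnC.
by apply: val_inj; rewrite !iter_restrict /= -!iterD subnK.
Qed.
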